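(* Let $m,k\ge 1$ be fixed integers, let $g:\mathbb{R}^{m\times k}\times\mathbb{R}\to[0,1]$ be a bounded kernel, and let $a\in\mathbb{R}$. Let $\boldsymbol{A}_1,\boldsymbol{A}_2,\dots$ be IID random vectors in $\mathbb{R}^m$, and for each $n\ge k$ let $\boldsymbol{A}=[\boldsymbol{A}_1,\dots,\boldsymbol{A}_n]$ be the $m\times n$ random matrix with these columns. Let $U_n(a)$ be the U-statistic of the sampled realization $\boldsymbol{\Phi}=\boldsymbol{A}$ corresponding to $g$, and let $p(a)=\mathbb{E}\,g(\boldsymbol{A}_{\mathcal{S}},a)=\mathbb{E}\,U_n(a)$ (for any size-$k$ subset $\mathcal{S}$; this does not depend on $\mathcal{S}$ or $n$). Then, almost surely, for all sufficiently large $n$, $$|U_n(a)-p(a)|\le \epsilon_n(a),\qquad\text{where}\quad \epsilon_n^2(a)=2\,p(a)\,(1-p(a))\cdot (n/k)^{-1}\log(n/k).$$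
   Context: A bounded kernel is a (measurable) function $g:\mathbb{R}^{m\times k}\times\mathbb{R}\to[0,1]$ such that $g(\mathbf{A},a)=g(\mathbf{A}',a)$ whenever $\mathbf{A}'$ is obtained from $\mathbf{A}$ by reordering columns. For an $m\times n$ matrix $\boldsymbol{\Phi}$ and a set $\mathcal{S}\subseteq\{1,\dots,n\}$ of column indices, $\boldsymbol{\Phi}_{\mathcal{S}}$ is the submatrix of $\boldsymbol{\Phi}$ consisting of the columns indexed by $\mathcal{S}$. The U-statistic of $\boldsymbol{\Phi}$ corresponding to $g$ is $$U_n(a)=\binom{n}{k}^{-1}\sum_{\mathcal{S}} g(\boldsymbol{\Phi}_{\mathcal{S}},a),$$ the sum being over all size-$k$ subsets $\mathcal{S}$ of $\{1,\dots,n\}$. *)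

(* Defs.v *)
From HB Require Import structures.
From mathcomp Require Import all_boot all_order all_algebra all_fingroup.
From mathcomp Require Import finmap.
From mathcomp Require Import all_classical all_reals all_analysis.

Set Implicit Arguments.
Unset Strict Implicit.
Unset Printing Implicit Defensive.

Import Order.TTheory GRing.Theory Num.Theory.
Import numFieldNormedType.Exports.

Local Open Scope classical_set_scope.
Local Open Scope ring_scope.

Definition measure_matrix_display : measure_display -> measure_display.
Proof. exact. Qed.

(* The product sigma-algebra on the space of matrices, generated by the entries;
   over a realType it is the Borel sigma-algebra of R^(m * n) *)
Section measurable_matrix.
Context {d} {T : measurableType d} (m n : nat).

Let measurable_matrix : set (set 'M[T]_(m, n)) :=
  <<s \bigcup_(ij : 'I_m * 'I_n)
        preimage_set_system setT (fun M : 'M[T]_(m, n) => M ij.1 ij.2)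
          measurable >>.

Let matrix_set0 : measurable_matrix set0.
Proof. exact: sigma_algebra0. Qed.

Let matrix_setC A : measurable_matrix A -> measurable_matrix (~` A).
Proof. exact: sigma_algebraC. Qed.

Let matrix_bigcup (F : (set 'M[T]_(m, n))^nat) :
  (forall i, measurable_matrix (F i)) -> measurable_matrix (\bigcup_i F i).
Proof. exact: sigma_algebra_bigcup. Qed.

HB.instance Definition _ := @isMeasurable.Build (measure_matrix_display d)
  'M[T]_(m, n) measurable_matrix matrix_set0 matrix_setC matrix_bigcup.

End measurable_matrix.

Section iid.
Local Open Scope ereal_scope.
Context {d d'} {T : measurableType d} {T' : measurableType d'} {R : realType}.
Variables (P : probability T R) (X : nat -> {RV P >-> T'}).

Definition mutually_independent : Prop :=
  forall (J : {fset nat}) (B : nat -> set T'),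
    (forall i, i \in J -> measurable (B i)) ->
    P (\bigcap_(i in [set` J]) (X i @^-1` B i)) =
    \prod_(i <- J) P (X i @^-1` B i).

(* Only measurable events are compared: the value of a measure on a
   non-measurable set is unspecified *)
Definition identically_distributed : Prop :=
  forall i j (B : set T'), measurable B ->
    distribution P (X i) B = distribution P (X j) B.

Definition iid : Prop := mutually_independent /\ identically_distributed.

End iid.

Section ustatistic.
Context {R : realType} {m k : nat}.
Implicit Types (g : 'M[R]_(m, k) -> R -> R) (a : R).

Definition bounded_kernel g : Prop :=
  [/\ measurable_fun setT (fun x : 'M[R]_(m, k) * R => g x.1 x.2),
      forall M a, 0 <= g M a <= 1 &
      forall (s : 'S_k) M a, g (col_perm s M) a = g M a].

(* The columns of Phi indexed by S, in increasing order; conform_mx only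
   identifies 'M_(m, #|S|) with 'M_(m, k), and yields the junk value 0 when
   #|S| <> k *)
Definition columns n (Phi : 'M[R]_(m, n)) (S : {set 'I_n}) : 'M[R]_(m, k) :=
  conform_mx 0 (colsub (@enum_val _ (mem S)) Phi).

Definition ustat g a n (Phi : 'M[R]_(m, n)) : R :=
  ('C(n, k)%:R)^-1 * \sum_(S : {set 'I_n} | #|S| == k) g (columns Phi S) a.

End ustatistic.

Section random_matrix.
Context {d} {T : measurableType d} {R : realType} {P : probability T R}.
Context {m : nat}.
Variable A : nat -> {RV P >-> 'cV[R]_m}.

Definition random_matrix n (w : T) : 'M[R]_(m, n) :=
  \matrix_(i < m, j < n) A j w i 0.

(* p(a), computed on the first k columns *)
Definition kernel_mean k (g : 'M[R]_(m, k) -> R -> R) (a : R) : R :=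
  fine 'E_P[fun w => g (random_matrix k w) a].

End random_matrix.

Definition epsilon {R : realType} (k : nat) (p : R) (n : nat) : R :=
  Num.sqrt (2 * p * (1 - p) * (n%:R / k%:R)^-1 * ln (n%:R / k%:R)).

(* Main.v *)
Require Import Defs.
From HB Require Import structures.
From mathcomp Require Import all_boot all_order all_algebra all_fingroup.
From mathcomp Require Import finmap.
From mathcomp Require Import all_classical all_reals all_analysis.
From mathcomp Require Import measurable_realfun.
From mathcomp Require Import ring lra zify.

(** By Hoeffding's representation, [U_n] is an average over permutations of
    means of [q = n %/ k] IID copies of [g], so by convexity of [exp] it obeys
    the Bernstein-type bound [P (|U_n - p| > t) <= 2 exp (- q t ^ 2 / (3 v))]
    for small [t], where [v = p (1 - p)] bounds the variance of [g].
    With [t] close to [epsilon_n] this is about [(n / k) ^ (- 2 / 3)], which is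
    not summable over [n] but is summable over the squares [n = i ^ 2], since
    the exponent exceeds [1 / 2].  As [|U_(n+1) - U_n| <= k / (n + 1)], the
    U-statistic moves by only [O(1 / i)] between [i ^ 2] and [(i + 1) ^ 2],
    which is negligible against [epsilon_n ~ sqrt (log i) / i].  If [v = 0],
    then [U_n = p] almost surely because [E (U_n - p) ^ 2 <= v]. *)

Set Implicit Arguments.
Unset Strict Implicit.
Unset Printing Implicit Defensive.

Import Order.TTheory GRing.Theory Num.Theory.
Import numFieldNormedType.Exports.

Local Open Scope classical_set_scope.
Local Open Scope ring_scope.

(** * Laws and independence of selected columns *)

Section matrix_measurability.
Context {d} {T : measurableType d}.

Lemma measurable_entry m n (i : 'I_m) (j : 'I_n) :
  measurable_fun setT (fun M : 'M[T]_(m, n) => M i j).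
Proof.
move=> _ B mB; apply: sub_sigma_algebra.
by exists (i, j) => //; exists B.
Qed.

Lemma measurable_fun_matrix d' (U : measurableType d') m n
    (f : U -> 'M[T]_(m, n)) :
  (forall i j, measurable_fun setT (fun x => f x i j)) -> measurable_fun setT f.
Proof.
move=> mf; pose G := \bigcup_(ij : 'I_m * 'I_n)
  preimage_set_system setT (fun M : 'M[T]_(m, n) => M ij.1 ij.2) measurable.
apply: (@measurability _ _ _ _ _ _ G) => // _ [_ [[i j] _ [B mB <-]] <-].
rewrite setTI.
have := mf i j measurableT B mB.
by rewrite !setTI; apply.
Qed.

Lemma measurable_colsub m n k (f : 'I_k -> 'I_n) :
  measurable_fun setT (fun M : 'M[T]_(m, n) => colsub f M).
Proof.
apply: measurable_fun_matrix => i j.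
under eq_fun do rewrite mxE.
exact: measurable_entry.
Qed.

Definition column_rectangle m n (B : 'I_n -> set 'cV[T]_m) :=
  [set M : 'M[T]_(m, n) | forall j, B j (col j M)].

Lemma measurable_column_rectangle m n (B : 'I_n -> set 'cV[T]_m) :
  (forall j, measurable (B j)) -> measurable (column_rectangle B).
Proof.
move=> mB.
have -> : column_rectangle B = \bigcap_j ((fun M => col j M) @^-1` B j).
  by apply/seteqP; split => M BM j; [move=> _|]; exact: BM.
apply: fin_bigcap_measurable => // j _; rewrite -[X in measurable X]setTI.
apply: measurable_fun_matrix => // i l.
under eq_fun do rewrite mxE.
exact: measurable_entry.
Qed.

(** Rectangles are stable under intersection, contain the whole space and generate the
    sigma-algebra, so the uniqueness theorem for finite measures on a pi-system applies. *)
Lemma column_rectangle_measure_unique {R : realType} m n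
    (mu1 mu2 : probability 'M[T]_(m, n) R) :
  (forall B, (forall j, measurable (B j)) ->
     mu1 (column_rectangle B) = mu2 (column_rectangle B)) ->
  forall E, measurable E -> mu1 E = mu2 E.
Proof.
move=> mu12 E mE.
pose G := [set column_rectangle B |
            B in [set B : 'I_n -> set 'cV[T]_m | forall j, measurable (B j)]].
have GT : G setT.
  exists (fun=> setT) => [j|]; first exact: measurableT.
  by apply/seteqP; split.
apply: (measure_unique G (fun=> setT)) => //.
- apply/seteqP; split.
    apply: smallest_sub; first exact: smallest_sigma_algebra.
    move=> _ [[i j] _ [B mB <-]]; apply: sub_sigma_algebra.
    (* A condition on the entry [(i, j)] is a rectangle in which only column [j] is constrained. *)
    exists (fun l => if l == j then (fun c : 'cV[T]_m => c i 0) @^-1` B else setT).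
      move=> l; case: ifP => // _; rewrite -[X in measurable X]setTI.
      exact: measurable_entry.
    apply/seteqP; split => [M /(_ j)|M [_ BM] l].
      by rewrite eqxx /= mxE.
    by case: ifP => // /eqP ->; rewrite /= mxE.
  apply: smallest_sub; first exact: sigma_algebra_measurable.
  by move=> _ [B mB <-]; exact: measurable_column_rectangle.
- move=> _ _ [B mB <-] [C mC <-]; exists (fun j => B j `&` C j).
    by move=> j; apply: measurableI; [exact: mB|exact: mC].
  apply/seteqP; split => M; first by move=> BC; split => j; case: (BC j).
  by move=> [BM CM] j; split; [exact: BM|exact: CM].
- by apply: bigcup_const; exists 0%N.
- by move=> _ [B mB <-]; exact: mu12.
- by move=> _; exact: le_lt_trans (probability_le1 mu1 measurableT) (ltry _).
Qed.

End matrix_measurability.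

(** * Selections of distinct columns: common law and independence *)

Section iid_columns.
Context {d} {T : measurableType d} {R : realType} {P : probability T R}.
Context {m : nat}.
Variable A : nat -> {RV P >-> 'cV[R]_m}.

(** Indices are taken in [nat], so selections of different sizes draw on the same sequence;
    [random_matrix A n] is, by conversion, the case where [f] is [@nat_of_ord n]. *)
Definition select_columns n (f : 'I_n -> nat) (w : T) : 'M[R]_(m, n) :=
  \matrix_(i < m, j < n) A (f j) w i 0.

Lemma measurable_select_columns n (f : 'I_n -> nat) :
  measurable_fun setT (select_columns f).
Proof.
apply: measurable_fun_matrix => i j; under eq_fun do rewrite mxE.
exact: (measurableT_comp (measurable_entry i 0)).
Qed.

HB.instance Definition _ n (f : 'I_n -> nat) :=
  isMeasurableFun.Build _ _ _ _ (select_columns f) (measurable_select_columns f).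

Hypothesis A_iid : iid A.

(** Independence speaks of events indexed by [nat], so [B] is carried along the injection [f] to a
    family [D]. Identical distribution then replaces the law of each [A (f j)] by that of [A 0]. *)
Lemma select_columns_rectangle n (f : 'I_n -> nat) B : injective f ->
  (forall j, measurable (B j)) ->
  distribution P (select_columns f) (column_rectangle B) =
  (\prod_(j < n) distribution P (A 0) (B j))%E.
Proof.
move=> injf mB; case: A_iid => indepA idA.
pose D l := if [pick j | f j == l] is Some j then B j else setT.
have Df j : D (f j) = B j.
  rewrite /D; case: pickP => [j' /eqP /injf -> //|/(_ j)]; by rewrite eqxx.
pose J := [fset f j | j in 'I_n]%fset.
have mD l : l \in J -> measurable (D l).
  by move=> /imfsetP[j _ ->]; rewrite Df.
have := indepA J D mD.
rewrite [RHS]big_imfset /=; last by move=> ? ? _ _; exact: injf.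
rewrite big_enum /= => indepAJ.
transitivity (P (\bigcap_(i in [set` J]) (A i @^-1` D i))).
  rewrite /distribution /pushforward; congr (P _).
  have colE w j : col j (select_columns f w) = A (f j) w.
    by apply/matrixP => i l; rewrite !mxE (ord1 l).
  apply/seteqP; split => w /= Bw.
    move=> _ /imfsetP[j _ ->] /=; rewrite Df -colE; exact: Bw.
  move=> j; rewrite colE -Df.
  by apply: Bw; apply/imfsetP; exists j.
rewrite indepAJ; apply: eq_bigr => j _; rewrite Df.
exact: idA.
Qed.

(** The value on rectangles does not involve [f], and rectangles determine the law. *)
Lemma select_columns_law n (f f' : 'I_n -> nat) E : injective f ->
  injective f' -> measurable E ->
  distribution P (select_columns f) E = distribution P (select_columns f') E.
Proof.
move=> injf injf'; apply: column_rectangle_measure_unique => B mB.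
by apply: etrans (select_columns_rectangle injf mB) _; rewrite -(select_columns_rectangle injf' mB).
Qed.

Lemma integral_select_columns n (f f' : 'I_n -> nat) (h : 'M[R]_(m, n) -> \bar R) :
  injective f -> injective f' -> measurable_fun setT h ->
  (forall M, 0 <= h M)%E ->
  (\int[P]_w h (select_columns f w) = \int[P]_w h (select_columns f' w))%E.
Proof.
move=> injf injf' mh h0.
rewrite -(ge0_integral_distribution (select_columns f))//.
rewrite -(ge0_integral_distribution (select_columns f'))//.
by apply: eq_measure_integral => E mE _; exact: select_columns_law.
Qed.

Lemma measurable_row_mx n n' : measurable_fun setT
  (fun M : 'M[R]_(m, n) * 'M[R]_(m, n') => row_mx M.1 M.2).
Proof.
apply: measurable_fun_matrix => i j; under eq_fun do rewrite mxE.
case: splitP => l _.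
  by apply: (measurableT_comp (measurable_entry i l)).
by apply: (measurableT_comp (measurable_entry i l)).
Qed.

(** The concatenated selection has the law of [row_mx] under the product of the two laws, since both
    give the same product on every rectangle. Tonelli's theorem then factors the integral. *)
Lemma select_columns_indep n n' (f : 'I_n -> nat) (f' : 'I_n' -> nat)
    (h : 'M[R]_(m, n) -> \bar R) (h' : 'M[R]_(m, n') -> \bar R) :
  injective f -> injective f' -> (forall i j, f i <> f' j) ->
  measurable_fun setT h -> (forall M, 0 <= h M)%E ->
  measurable_fun setT h' -> (forall M, 0 <= h' M)%E ->
  (\int[P]_w (h (select_columns f w) * h' (select_columns f' w)) =
   (\int[P]_w h (select_columns f w)) * (\int[P]_w h' (select_columns f' w)))%E.
Proof.
move=> injf injf' disj mh h0 mh' h'0.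
(* The concatenation is again injective because the ranges of [f] and [f'] are disjoint. *)
pose ff (j : 'I_(n + n')) := match fintype.split j with inl i => f i | inr i => f' i end.
have injff : injective ff.
  move=> i j; rewrite -(splitK i) -(splitK j) /ff !unsplitK.
  case: (fintype.split i) => i'; case: (fintype.split j) => j' /=.
  - by move=> /injf ->.
  - by move=> /disj.
  - by move=> /esym /disj.
  - by move=> /injf' ->.
pose rx : {mfun ('M[R]_(m, n) * 'M[R]_(m, n'))%type >-> 'M[R]_(m, n + n')} :=
  mfun_Sub (mem_set (@measurable_row_mx n n')).
pose mu1 := distribution P (select_columns f).
pose mu2 := distribution P (select_columns f').
pose prod := (mu1 \x mu2)%E : probability _ R.
have law E : measurable E ->
    distribution P (select_columns ff) E = distribution prod rx E.
  apply: column_rectangle_measure_unique => B mB.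
  apply: etrans (select_columns_rectangle injff mB) _; apply/esym.
  change ((mu1 \x mu2)%E (rx @^-1` column_rectangle B) =
    \prod_(j < n + n') distribution P (A 0) (B j))%E.
  have -> : rx @^-1` column_rectangle B =
      column_rectangle (fun j => B (lshift n' j)) `*`
      column_rectangle (fun j => B (rshift n j)).
    apply/seteqP; split => [[M1 M2] /= BM|[M1 M2] /= [B1 B2] j].
      split => j; first by have := BM (lshift n' j); rewrite colKl.
      by have := BM (rshift n j); rewrite colKr.
    rewrite -(splitK j); case: (fintype.split j) => l /=.
      by rewrite colKl; exact: B1.
    by rewrite colKr; exact: B2.
  have mB1 := measurable_column_rectangle (fun j => mB (lshift n' j)).
  have mB2 := measurable_column_rectangle (fun j => mB (rshift n j)).
  rewrite product_measure1E// big_split_ord; congr (_ * _)%E.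
    by apply: select_columns_rectangle => // j.
  by apply: select_columns_rectangle => // j.
pose H (M : 'M[R]_(m, n + n')) := (h (lsubmx M) * h' (rsubmx M))%E.
have mH : measurable_fun setT H.
  apply: emeasurable_funM; apply: measurableT_comp => //.
    apply: measurable_fun_matrix => i j; under eq_fun do rewrite mxE.
    exact: measurable_entry.
  apply: measurable_fun_matrix => i j; under eq_fun do rewrite mxE.
  exact: measurable_entry.
have H0 M : (0 <= H M)%E by rewrite mule_ge0.
transitivity (\int[distribution P (select_columns ff)]_M H M)%E.
  rewrite ge0_integral_distribution//; apply: eq_integral => w _.
  rewrite /H /=; congr (h _ * h' _)%E; apply/matrixP => i j; rewrite !mxE /ff.
    by rewrite (unsplitK (inl j)).
  by rewrite (unsplitK (inr j)).
transitivity (\int[distribution prod rx]_M H M)%E.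
  by apply: eq_measure_integral => E mE _; exact: law.
rewrite ge0_integral_distribution//.
rewrite fubini_tonelli1; last 2 first.
- by apply: (measurableT_comp mH); exact: measurable_row_mx.
- by move=> M; exact: H0.
rewrite -[X in (X * _)%E](ge0_integral_distribution (select_columns f))//.
rewrite -[X in (_ * X)%E](ge0_integral_distribution (select_columns f'))//.
rewrite -/mu1 -/mu2 /fubini_F.
transitivity (\int[mu1]_x (h x * (\int[mu2]_y h' y)))%E.
  apply: eq_integral => M _; rewrite -ge0_integralZl//.
  apply: eq_integral => M' _; rewrite /H /=.
  by rewrite row_mxKl row_mxKr.
rewrite ge0_integralZr//.
by apply: integral_ge0 => M _; exact: h'0.
Qed.

End iid_columns.

(** * Products over disjoint blocks of columns *)

Section iid_blocks.
Context {d} {T : measurableType d} {R : realType} {P : probability T R}.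
Context {m : nat}.
Variable A : nat -> {RV P >-> 'cV[R]_m}.
Hypothesis A_iid : iid A.

Lemma block_subproof k q (b : 'I_q) (j : 'I_k) : (b * k + j < q * k)%N.
Proof.
rewrite (@leq_trans (b.+1 * k)%N) ?leq_mul2r ?ltn_ord ?orbT//.
by rewrite mulSn addnC ltn_add2r.
Qed.

(** The value [b * k + j] does not depend on [q], which lets an induction on [q] keep the earlier
    blocks unchanged. *)
Definition block_index k q (b : 'I_q) (j : 'I_k) := Ordinal (block_subproof b j).

Lemma emeasurable_prod d' (U : measurableType d') (I : Type) (s : seq I)
    (f : I -> U -> \bar R) : (forall i, measurable_fun setT (f i)) ->
  measurable_fun setT (fun x => \prod_(i <- s) f i x)%E.
Proof.
move=> mf; elim: s => [|i s IHs].
  under eq_fun do rewrite big_nil.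
  exact: measurable_cst.
under eq_fun do rewrite big_cons.
exact: emeasurable_funM.
Qed.

(** Induction on [q]: the last block shares no column with the first [q * k] ones, so its factor
    splits off, and its integral is that of the first [k] columns. *)
Lemma integral_block_product k q (f : nat -> nat) (h : 'M[R]_(m, k) -> \bar R) :
  injective f -> measurable_fun setT h -> (forall M, 0 <= h M)%E ->
  (\int[P]_w (\prod_(b < q) h (select_columns A (f \o block_index b) w)) =
   (\int[P]_w h (random_matrix A k w)) ^+ q)%E.
Proof.
move=> injf mh h0; elim: q => [|q IHq].
  under eq_integral do rewrite big_ord0.
  by rewrite integral_cst// mul1e expe0; exact: probability_setT.
(* The first [q] factors form one function of a single matrix, so independence of two selections
   suffices. *)
pose G (M : 'M[R]_(m, q * k)) := (\prod_(b < q) h (colsub (block_index b) M))%E.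
have mG : measurable_fun setT G.
  apply: emeasurable_prod => b _.
  exact: (measurableT_comp mh (measurable_colsub (block_index b))).
have G0 M : (0 <= G M)%E by apply: prode_ge0 => b _.
rewrite expeS muleC -IHq.
transitivity (\int[P]_w (G (select_columns A (f \o @nat_of_ord _) w) *
    h (select_columns A (fun j : 'I_k => f (q * k + j)%N) w)))%E.
  apply: eq_integral => w _; rewrite big_ord_recr; congr (_ * _)%E.
    apply: eq_bigr => b _; congr (h _).
    by apply/matrixP => i j; rewrite !mxE.
have injq : injective (fun j : 'I_k => f (q * k + j)%N).
  by move=> i j /injf /addnI; exact: val_inj.
have injv : injective (f \o @nat_of_ord (q * k)).
  by move=> i j /injf; exact: val_inj.
have disj (i : 'I_(q * k)) (j : 'I_k) : (f \o @nat_of_ord _) i <> f (q * k + j)%N.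
  by move=> /injf ij; have := ltn_ord i; rewrite {1}ij ltnNge leq_addr.
rewrite (select_columns_indep A_iid injv injq disj)//; congr (_ * _)%E.
  apply: eq_integral => w _; apply: eq_bigr => b _; congr (h _).
  by apply/matrixP => i j; rewrite !mxE.
exact: (integral_select_columns A_iid injq (@ord_inj k)).
Qed.

End iid_blocks.

(** * Permutation form and increments of a U-statistic *)

Section subset_average.
Context {R : realFieldType}.

(** List each set followed by its complement. Matching equal positions of the two lists is a
    bijection, and it takes [B] to [S] because the initial segments have the same length. *)
Lemma exists_perm_imset (I : finType) (B S : {set I}) : #|B| = #|S| ->
  exists s : {perm I}, s @: B = S.
Proof.
move=> BS.
pose e (C : {set I}) := enum C ++ enum (~: C).
have ue C : uniq (e C).
  rewrite cat_uniq !enum_uniq andbT /=; apply/hasPn => x.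
  by rewrite !mem_enum inE.
have me C x : x \in e C by rewrite mem_cat !mem_enum inE orbN.
have se C : size (e C) = #|I| by rewrite size_cat -!cardE cardsC.
pose f x := nth x (e S) (index x (e B)).
have ix x : (index x (e B) < size (e S))%N by rewrite se -(se B) index_mem.
have injf : injective f.
  move=> x y /eqP; rewrite /f (set_nth_default y x)// nth_uniq// => /eqP ixy.
  by rewrite -(nth_index x (me B x)) ixy nth_index.
exists (perm injf); apply/eqP; rewrite eqEcard card_imset; last exact: perm_inj.
rewrite BS leqnn andbT; apply/fintype.subsetP => _ /imsetP[x xB ->]; rewrite permE /f.
have xk : (index x (e B) < size (enum S))%N.
  by rewrite index_cat mem_enum xB -cardE -BS cardE index_mem mem_enum.
by rewrite nth_cat xk -mem_enum mem_nth.
Qed.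

(** The permutations taking [B] to a given [S] form a coset of the stabiliser of [B], so every [S]
    is hit equally often, [c] times. The constant function 1 then yields the value of [c]. *)
Lemma sum_perm_imset n k (F : {set 'I_n} -> R) (B : {set 'I_n}) : #|B| = k ->
  (\sum_(s : 'S_n) F (s @: B)) * 'C(n, k)%:R =
  n`!%:R * \sum_(S : {set 'I_n} | #|S| == k) F S.
Proof.
move=> Bk.
pose c := #|[pred s : 'S_n | s @: B == B]|.
have sumE (G : {set 'I_n} -> R) :
    \sum_(s : 'S_n) G (s @: B) = c%:R * \sum_(S : {set 'I_n} | #|S| == k) G S.
  rewrite (partition_big (fun s : 'S_n => s @: B) (fun S => #|S| == k)) /=; last first.
    by move=> s _; rewrite card_imset ?Bk//; exact: perm_inj.
  rewrite mulr_sumr; apply: eq_bigr => S /eqP Sk.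
  have [t tB] : exists t : 'S_n, t @: B = S by apply: exists_perm_imset; rewrite Bk.
  have stB s : ((s * t)%g @: B == S) = (s @: B == B).
    have -> : (s * t)%g @: B = t @: (s @: B).
      by rewrite -imset_comp; apply: eq_imset => x; rewrite /= permM.
    by rewrite -tB (inj_eq (imset_inj (@perm_inj _ t))).
  rewrite (reindex_inj (mulIg t)) /= (eq_bigr (fun=> G S)); last first.
    by move=> s /eqP <-.
  rewrite sumr_const mulr_natl /c; congr (_ *+ _).
  by apply: eq_card => s; exact: stB.
have cn : c%:R * 'C(n, k)%:R = n`!%:R :> R.
  have := sumE (fun=> 1); rewrite !sumr_const -card_Sn => ->.
  by rewrite -{1}(card_ord n) -card_draws cardsE.
by rewrite sumE -cn mulrAC.
Qed.

End subset_average.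

Section ustat.
Context {R : realType} {m k : nat}.
Variables (g : 'M[R]_(m, k) -> R -> R) (a : R).
Hypothesis g_kernel : bounded_kernel g.

(** The increasing enumeration of the image and [f] differ by the permutation [r], which the
    symmetric kernel ignores. *)
Lemma kernel_columns_imset n (Phi : 'M[R]_(m, n)) (f : 'I_k -> 'I_n) :
  injective f -> g (columns Phi (f @: 'I_k)) a = g (colsub f Phi) a.
Proof.
move=> injf; case: g_kernel => _ _ g_sym.
pose S := f @: 'I_k.
have Sk : #|S| = k by rewrite card_imset// card_ord.
have fS j : f j \in S by exact: imset_f.
(* As [#|S| = k], [conform_mx] is a mere cast here and does not return its default value. *)
have colE : columns Phi S =
    colsub (fun j => enum_val (cast_ord (esym Sk) j)) Phi :> 'M[R]_(m, k).
  rewrite /columns -(conform_castmx (erefl m, Sk)) conform_mx_id.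
  by apply/matrixP => i j; rewrite castmxE !mxE cast_ord_id.
pose r j := cast_ord Sk (enum_rank_in (fS j) (f j)).
have rE j : enum_val (cast_ord (esym Sk) (r j)) = f j.
  by rewrite cast_ordK enum_rankK_in.
have injr : injective r by move=> i j rij; apply: injf; rewrite -!rE rij.
rewrite -/S colE -(g_sym (perm injr)); congr (g _ _).
by apply/matrixP => i j; rewrite !mxE permE rE.
Qed.

Lemma ustat_bounded n (Phi : 'M[R]_(m, n)) : 0 <= ustat g a Phi <= 1.
Proof.
case: g_kernel => _ g01 _; apply/andP; split.
  rewrite mulr_ge0 ?invr_ge0// sumr_ge0// => S _.
  by have /andP[] := g01 (columns Phi S) a.
(* If [n < k], the binomial coefficient and its inverse are both 0, hence so is the U-statistic. *)
have [C0|C0] := posnP 'C(n, k); first by rewrite /ustat C0 invr0 mul0r.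
rewrite /ustat mulrC ler_pdivrMr ?ltr0n// mul1r.
rewrite (@le_trans _ _ (\sum_(S : {set 'I_n} | #|S| == k) 1))//.
  by apply: ler_sum => S _; have /andP[] := g01 (columns Phi S) a.
by rewrite sumr_const -cardsE card_draws card_ord.
Qed.

(** Hoeffding's representation: for each fixed [b], the image of [e b] under a uniform permutation
    is a uniform subset of size [k], so the average over [s] is already the U-statistic. *)
Lemma ustat_perm_blocks n q (Phi : 'M[R]_(m, n)) (e : 'I_q -> 'I_k -> 'I_n) :
  (0 < q)%N -> (k <= n)%N -> (forall b, injective (e b)) ->
  ustat g a Phi = (n`!%:R)^-1 * \sum_(s : 'S_n)
    (q%:R^-1 * \sum_(b < q) g (colsub (s \o e b) Phi) a).
Proof.
move=> q0 kn inje.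
have C0 : 'C(n, k)%:R != 0 :> R by rewrite pnatr_eq0 -lt0n bin_gt0.
have n0 : n`!%:R != 0 :> R by rewrite pnatr_eq0 -lt0n fact_gt0.
have qn0 : q%:R != 0 :> R by rewrite pnatr_eq0 -lt0n.
pose F S := g (columns Phi S) a.
rewrite -mulr_sumr exchange_big /=.
rewrite (eq_bigr (fun=> n`!%:R * ustat g a Phi)); last first.
  move=> b _; rewrite /ustat mulrCA -(@sum_perm_imset _ _ _ F (e b @: 'I_k)).
    rewrite mulrC mulfK//; apply: eq_bigr => s _.
    rewrite /F -imset_comp kernel_columns_imset//.
    by apply: inj_comp => //; exact: perm_inj.
  by rewrite card_imset// card_ord.
by rewrite sumr_const card_ord -[X in _ * (_ * X)]mulr_natl mulKf// mulKf.
Qed.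

End ustat.

(** * Effect of adding one column *)

Section ustat_increment.
Context {R : realType} {m k : nat}.
Variables (g : 'M[R]_(m, k) -> R -> R) (a : R).
Hypothesis g_kernel : bounded_kernel g.

Lemma card_eq_imset n (S : {set 'I_n}) : #|S| = k ->
  exists2 f : 'I_k -> 'I_n, injective f & S = f @: 'I_k.
Proof.
move=> Sk; exists (fun j => enum_val (cast_ord (esym Sk) j)).
  by move=> i j /enum_val_inj /cast_ord_inj.
apply/setP => x; apply/idP/imsetP => [xS|[j _ ->]]; last exact: enum_valP.
by exists (cast_ord Sk (enum_rank_in xS x)) => //; rewrite cast_ordK enum_rankK_in.
Qed.

(** Pascal's rule for sums: the subsets that avoid [ord_max] are the images of the subsets of ['I_n]
    under [lift ord_max]. *)
Lemma sum_subsets_recr n (F : {set 'I_n.+1} -> R) :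
  \sum_(S : {set 'I_n.+1} | #|S| == k) F S =
  \sum_(S : {set 'I_n} | #|S| == k) F (lift ord_max @: S) +
  \sum_(S : {set 'I_n.+1} | (#|S| == k) && (ord_max \in S)) F S.
Proof.
rewrite (bigID (fun S : {set 'I_n.+1} => ord_max \in S)) /= addrC; congr (_ + _).
rewrite (reindex_onto (fun S : {set 'I_n} => lift ord_max @: S)
  (fun S => lift ord_max @^-1: S)) /=.
  apply: eq_bigl => S; rewrite card_imset; last exact: lift_inj.
  have -> : lift ord_max @^-1: (lift ord_max @: S) = S.
    by apply/setP => x; rewrite inE mem_imset//; exact: lift_inj.
  rewrite eqxx andbT; case: (#|S| == k) => //=.
  by apply/imsetP => -[x _ /eqP]; rewrite (negPf (neq_lift _ _)).
move=> S /andP[_ nS]; apply/setP => x; apply/imsetP/idP => [[y + ->]|xS].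
  by rewrite inE.
case: (unliftP ord_max x) => [y xy|xm]; last by rewrite xm (negPf nS) in xS.
by exists y; rewrite // inE -xy.
Qed.

(** Let [W] be the sum over the subsets containing the new index, of which there are
    [c = 'C(n, k.-1)]. The difference is [(W - c * U) / 'C(n.+1, k)] with [W] and [c * U] both in
    [[0, c]], and [c / 'C(n.+1, k) = k / n.+1]. *)
Lemma ustat_increment n (Phi : 'M[R]_(m, n.+1)) : (0 < k)%N -> (k <= n)%N ->
  `|ustat g a Phi - ustat g a (colsub (lift ord_max) Phi)| <= k%:R / n.+1%:R.
Proof.
move=> k0 kn; have [_ g01 _] := g_kernel.
pose F (S : {set 'I_n.+1}) := g (columns Phi S) a.
have FE (S : {set 'I_n}) : #|S| == k ->
    F (lift ord_max @: S) = g (columns (colsub (lift ord_max) Phi) S) a.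
  move=> /eqP /card_eq_imset[f injf ->]; rewrite /F -imset_comp.
  rewrite !kernel_columns_imset//; last by apply: inj_comp => //; exact: lift_inj.
  by congr (g _ _); apply/matrixP => i j; rewrite !mxE.
have /andP[U0 U1] := ustat_bounded a g_kernel (colsub (lift ord_max) Phi).
set U := ustat g a (colsub _ _) in U0 U1 *.
have C0 : 0 < 'C(n, k)%:R :> R by rewrite ltr0n bin_gt0.
have C'0 : 0 < 'C(n.+1, k)%:R :> R by rewrite ltr0n bin_gt0 leqW.
pose c : R := 'C(n, k.-1)%:R.
have C'E : 'C(n.+1, k)%:R = 'C(n, k)%:R + c :> R.
  by have := binS n k.-1; rewrite (prednK k0) => ->; rewrite natrD.
have cE : k%:R / n.+1%:R = c / 'C(n.+1, k)%:R.
  apply/eqP; rewrite eqr_div ?pnatr_eq0 -?lt0n ?bin_gt0 ?(leqW kn)//.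
  have := mul_bin_diag n.+1 k.-1; rewrite (prednK k0) => kC.
  by rewrite -!natrM -kC mulnC.
pose W := \sum_(S : {set 'I_n.+1} | (#|S| == k) && (ord_max \in S)) F S.
have W0 : 0 <= W by apply: sumr_ge0 => S _; have /andP[] := g01 (columns Phi S) a.
have Wc : W <= c.
  (* For the constant function 1 the recursion counts the subsets containing [ord_max]. *)
  have := @sum_subsets_recr n (fun=> 1); rewrite !sumr_const.
  have cardk l : #|(fun S : {set 'I_l} => #|S| == k)| = 'C(l, k).
    by rewrite -[in RHS](card_ord l) -card_draws cardsE.
  rewrite !cardk C'E => /addrI ->.
  rewrite -sumr_const; apply: ler_sum => S _.
  by have /andP[] := g01 (columns Phi S) a.
have UE : ustat g a Phi = ('C(n, k)%:R * U + W) / 'C(n.+1, k)%:R.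
  rewrite mulrC /ustat sum_subsets_recr -/W; congr (_ * (_ + _)).
  by rewrite /U /ustat mulVKf ?gt_eqF//; exact: eq_bigr.
have C'n0 : 'C(n.+1, k)%:R != 0 :> R by rewrite gt_eqF.
rewrite cE UE -[X in `|_ - X|](mulfK C'n0) -mulrBl normrM.
rewrite [X in _ * X]ger0_norm ?invr_ge0 ?ler0n// ler_pM2r ?invr_gt0//.
have c0 : 0 <= c by rewrite ler0n.
have cU0 : 0 <= c * U by rewrite mulr_ge0.
have cU1 : c * U <= c by rewrite ler_piMr.
have -> : 'C(n, k)%:R * U + W - U * 'C(n.+1, k)%:R = W - c * U.
  by rewrite C'E; ring.
by rewrite ler_norml; apply/andP; split; lra.
Qed.

End ustat_increment.

(** * Moments and deviations of a U-statistic *)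

(** Jensen's inequality for the uniform average. *)
Lemma expR_average {R : realType} (I : finType) (x : I -> R) : (0 < #|I|)%N ->
  expR (#|I|%:R^-1 * \sum_i x i) <= #|I|%:R^-1 * \sum_i expR (x i).
Proof.
move=> I0; set c := _ * \sum_i x i.
have N0 : 0 < #|I|%:R :> R by rewrite ltr0n.
(* the graph of [expR] lies above its tangent at the mean [c] *)
have tangent i : expR c * (1 + (x i - c)) <= expR (x i).
  have -> : expR (x i) = expR c * expR (x i - c) by rewrite -expRD addrC subrK.
  by rewrite ler_pM2l ?expR_gt0// expR_ge1Dx.
rewrite mulrC ler_pdivlMr//.
apply: le_trans (ler_sum _ (fun i _ => tangent i)).
rewrite -mulr_sumr ler_pM2l ?expR_gt0// big_split /= sumrB !sumr_const.
by rewrite -[c *+ _]mulr_natl /c mulVKf ?gt_eqF// subrr addr0.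
Qed.

(** With [y = x / 4], the fourth power of [expR y <= (1 - y)^-1] reduces the claim to a polynomial
    inequality. A quadratic coefficient [c] leads to a tail of order [(n / k) ^ (- 1 / (2 c))];
    [c = 3 / 4] is below 1, as summability over squares demands. *)
Lemma expR_le_quadratic {R : realType} (x : R) : `|x| <= 1 / 4 ->
  expR x <= 1 + x + 3 / 4 * x ^+ 2.
Proof.
rewrite ler_norml => /andP[x1 x2]; pose y := x / 4.
have y1 : - (1 / 16) <= y by rewrite /y; lra.
have y2 : y <= 1 / 16 by rewrite /y; lra.
have -> : x = 4 * y by rewrite /y; field.
rewrite expRM_natl.
have y1' : 0 < 1 - y by lra.
have e1 : expR y <= (1 - y)^-1.
  rewrite -[y in expR y]opprK expRN lef_pV2 ?posrE ?expR_gt0//.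
  exact: expR_ge1Dx.
have e4 : expR y ^+ 4 <= ((1 - y)^-1) ^+ 4.
  by rewrite lerXn2r// nnegrE ?expR_ge0// invr_ge0 ltW.
apply: le_trans e4 _; rewrite exprVn -[leLHS]mul1r ler_pdivrMr ?exprn_gt0//.
rewrite -subr_ge0.
(* Terms of order 0 and 1 cancel; the remaining factor is positive since [28 * y <= 7 / 4 < 2]. *)
have -> : (1 + 4 * y + 3 / 4 * (4 * y) ^+ 2) * (1 - y) ^+ 4 - 1 =
  y ^+ 2 * (2 - 28 * y + y ^+ 2 * (57 - 44 * y + 12 * y ^+ 2)) by field.
apply: mulr_ge0; first exact: sqr_ge0.
have z0 := sqr_ge0 y.
have : 0 <= y ^+ 2 * (57 - 44 * y + 12 * y ^+ 2).
  by apply: mulr_ge0 => //; lra.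
lra.
Qed.

(** Extension by the identity beyond [n], giving the injection of [nat] that
    [integral_block_product] takes. *)
Lemma perm_nat_ext n (s : 'S_n) : exists2 f : nat -> nat, injective f &
  forall i : 'I_n, f i = s i.
Proof.
exists (fun i => if insub i is Some j then val (s j) else i) => [i j|i]; last first.
  by rewrite valK.
case: insubP => [i' _ <-|ni]; case: insubP => [j' _ <-|nj] //=.
- by move=> /val_inj /perm_inj ->.
- by move=> sj; rewrite -sj ltn_ord in nj.
- by move=> si; rewrite si ltn_ord in ni.
Qed.

(** * Mean, degenerate case, moment generating function and tails *)

Section ustat_moments.
Context {d} {T : measurableType d} {R : realType} {P : probability T R}.
Context {m k : nat}.
Variables (g : 'M[R]_(m, k) -> R -> R) (a : R) (A : nat -> {RV P >-> 'cV[R]_m}).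
Hypothesis g_kernel : bounded_kernel g.
Hypothesis A_iid : iid A.
Let p := kernel_mean A g a.
Let U n w := ustat g a (random_matrix A n w).

Lemma measurable_kernel : measurable_fun setT (fun M : 'M[R]_(m, k) => g M a).
Proof.
case: g_kernel => mg _ _; exact: (measurable_fun_pair1 a mg).
Qed.

Lemma colsub_random_matrix n l (f : 'I_l -> 'I_n) w :
  colsub f (random_matrix A n w) = select_columns A (fun j => f j) w.
Proof. by apply/matrixP => i j; rewrite !mxE. Qed.

Lemma measurable_kernel_select (f : 'I_k -> nat) :
  measurable_fun setT (fun w => g (select_columns A f w) a).
Proof.
exact: (measurableT_comp measurable_kernel (measurable_select_columns A f)).
Qed.

Lemma integrable_bounded01 (X : T -> R) : measurable_fun setT X ->
  (forall w, 0 <= X w <= 1) -> P.-integrable setT (EFin \o X).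
Proof.
move=> mX X01; apply: (le_integrable measurableT (g := EFin \o cst 1)).
- exact/measurable_EFinP.
- move=> w _ /=; rewrite lee_fin normr1; have /andP[X0 X1] := X01 w.
  by rewrite ger0_norm.
- exact: finite_measure_integrable_cst.
Qed.

Lemma integral_affine (X : T -> R) (mu alpha beta : R) : measurable_fun setT X ->
  (forall w, 0 <= X w <= 1) -> (\int[P]_w (X w)%:E = mu%:E)%E ->
  (\int[P]_w (alpha + beta * X w)%:E = (alpha + beta * mu)%:E)%E.
Proof.
move=> mX X01 EX; have iX := integrable_bounded01 mX X01.
have iZ : P.-integrable setT (EFin \o (fun w => beta * X w)).
  have := integrableZl measurableT beta iX; apply: eq_integrable => // w _.
rewrite (_ : (fun w => (alpha + beta * X w)%:E) =
  ((EFin \o cst alpha) \+ (EFin \o (fun w => beta * X w)%R))%E)//.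
rewrite integralD_EFin//; last exact: finite_measure_integrable_cst.
rewrite EFinD EFinM; congr (_ + _)%E; last by rewrite -EX -integralZl.
transitivity (alpha%:E * P setT)%E; first by rewrite -(integral_cst _ measurableT).
by rewrite -[RHS]mule1; congr (_ * _)%E; exact: probability_setT.
Qed.

Lemma kernel_mean_select (f : 'I_k -> nat) : injective f ->
  (\int[P]_w (g (select_columns A f w) a)%:E = p%:E)%E.
Proof.
move=> injf; have [_ g01 _] := g_kernel.
have mgE : measurable_fun setT (fun M : 'M[R]_(m, k) => (g M a)%:E).
  by apply/measurable_EFinP; exact: measurable_kernel.
rewrite (integral_select_columns A_iid injf (@ord_inj k) mgE); last first.
  by move=> M; rewrite lee_fin; have /andP[] := g01 M a.
(* [fine] loses nothing: the integrand lies in [[0, 1]]. *)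
rewrite /p /kernel_mean unlock fineK//.
apply: integrable_fin_num => //; apply: integrable_bounded01.
  exact: measurable_kernel_select.
by move=> w; exact: g01.
Qed.

Lemma kernel_mean_bounded : 0 <= p <= 1.
Proof.
have g01 w : 0 <= g (select_columns A (@nat_of_ord k) w) a <= 1.
  by case: g_kernel.
have g0 w : 0 <= g (select_columns A (@nat_of_ord k) w) a by case/andP: (g01 w).
rewrite -!lee_fin -(kernel_mean_select (@ord_inj k)); apply/andP; split.
  by apply: integral_ge0 => w _; rewrite lee_fin.
rewrite -(_ : \int[P]_w (cst 1 w) = 1)%E; last first.
  by rewrite integral_cst// mul1e; exact: probability_setT.
apply: ge0_le_integral => //.
- by move=> w _; rewrite lee_fin.
- by apply/measurable_EFinP; exact: measurable_kernel_select.
- by move=> w _; rewrite lee_fin; case/andP: (g01 w).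
Qed.

Lemma kernel_mean_columns n (S : {set 'I_n}) : #|S| = k ->
  ('E_P[fun w => g (columns (random_matrix A n w) S) a] = p%:E)%E.
Proof.
move=> /card_eq_imset[f injf ->]; rewrite unlock -(@kernel_mean_select f).
  by apply: eq_integral => w _; rewrite kernel_columns_imset// colsub_random_matrix.
by apply: inj_comp => //; exact: ord_inj.
Qed.

(** Hoeffding's representation for [q] consecutive blocks: for each [s], the inner mean runs over
    disjoint sets of columns. With [q = 1] it also gives measurability and the mean. *)
Lemma ustat_select n q (kn : (k <= n)%N) (qkn : (q * k <= n)%N) w : (0 < q)%N ->
  U n w = n`!%:R^-1 * \sum_(s : 'S_n) (q%:R^-1 *
    \sum_(b < q) g (select_columns A (fun j => s (widen_ord qkn (block_index b j))) w) a).
Proof.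
move=> q0; rewrite /U (@ustat_perm_blocks _ _ _ g a g_kernel n q _
  (fun b j => widen_ord qkn (block_index b j)))//.
  congr (_ * _); apply: eq_bigr => s _; congr (_ * _); apply: eq_bigr => b _.
  by rewrite colsub_random_matrix.
by move=> b i j [/addnI]; exact: ord_inj.
Qed.

Lemma measurable_ustat n : (k <= n)%N -> measurable_fun setT (U n).
Proof.
move=> kn; have kn1 : (1 * k <= n)%N by rewrite mul1n.
rewrite (funext (fun w => ustat_select kn kn1 w isT)).
apply: measurable_funM; first exact: measurable_cst.
apply: measurable_sum => s; apply: measurable_funM; first exact: measurable_cst.
by apply: measurable_sum => b; exact: measurable_kernel_select.
Qed.

Lemma expectation_ustat n : (k <= n)%N -> (\int[P]_w (U n w)%:E = p%:E)%E.
Proof.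
move=> kn; have kn1 : (1 * k <= n)%N by rewrite mul1n.
have g0 M : 0 <= g M a by case: g_kernel => _ /(_ M a) /andP[].
have n0 : n`!%:R != 0 :> R by rewrite pnatr_eq0 -lt0n fact_gt0.
pose f (s : 'S_n) (j : 'I_k) : nat := s (widen_ord kn1 (block_index (ord0 : 'I_1) j)).
have injf s : injective (f s).
  by move=> i j /ord_inj /perm_inj [] /val_inj.
have UE w : (U n w)%:E =
    ((n`!%:R^-1)%:E * \sum_(s : 'S_n) (g (select_columns A (f s) w) a)%:E)%E.
  rewrite (ustat_select kn kn1)// EFinM sumEFin; congr (_ * _%:E)%E.
  by apply: eq_bigr => s _; rewrite invr1 mul1r big_ord1.
under eq_integral do rewrite UE.
rewrite ge0_integralZl//; last 2 first.
- by apply: emeasurable_sum => s; apply/measurable_EFinP; exact: measurable_kernel_select.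
- by move=> w _; apply: sume_ge0 => s _; rewrite lee_fin.
rewrite ge0_integral_sum//; last 2 first.
- by move=> s; apply/measurable_EFinP; exact: measurable_kernel_select.
- by move=> s w _; rewrite lee_fin.
under eq_bigr do rewrite kernel_mean_select//.
by rewrite sumEFin sumr_const -EFinM card_Sn -[p *+ _]mulr_natl mulKf.
Qed.

(** Since [U ^ 2 <= U] on [[0, 1]], the square [(U - p) ^ 2] is at most [p ^ 2 + (1 - 2 p) U], whose
    mean is [p (1 - p) = 0]. *)
Lemma degenerate_ustat n : (k <= n)%N -> p * (1 - p) = 0 ->
  {ae P, forall w, U n w = p}.
Proof.
move=> kn p01.
have U01 w : 0 <= U n w <= 1 by exact: ustat_bounded.
have mU := measurable_ustat kn.
have mD : measurable_fun setT (fun w => ((U n w - p) ^+ 2)%:E).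
  apply/measurable_EFinP; apply: measurable_funX; apply: measurable_funB => //.
have D0 : (\int[P]_w `|((U n w - p) ^+ 2)%:E| = 0)%E.
  apply/eqP; rewrite eq_le integral_ge0 ?andbT//.
  have <- : (\int[P]_w (p ^+ 2 + (1 - 2 * p) * U n w)%:E = 0)%E.
    rewrite (integral_affine _ _ mU U01 (expectation_ustat kn)); congr EFin.
    by rewrite -p01; ring.
  apply: ge0_le_integral => //.
  - by apply: measurableT_comp.
  - apply/measurable_EFinP; apply: measurable_funD; first exact: measurable_cst.
    by apply: measurable_funM => //; exact: measurable_cst.
  - move=> w _; rewrite lee_fin ger0_norm ?sqr_ge0//.
    have /andP[U0 U1] := U01 w.
    have : 0 <= U n w * (1 - U n w) by rewrite mulr_ge0 ?subr_ge0.
    lra.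
have := (ae_eq_integral_abs P measurableT mD).1 D0.
apply: filterS => w /(_ I) [] /eqP; rewrite sqrf_eq0 subr_eq0 => /eqP //.
Qed.

Definition kernel_mgf (s : R) : \bar R :=
  (\int[P]_w (expR (s * (g (random_matrix A k w) a - p)))%:E)%E.

Lemma kernel_mgf_le s : `|s| <= 1 / 4 ->
  (kernel_mgf s <= (expR (3 / 4 * s ^+ 2 * (p * (1 - p))))%:E)%E.
Proof.
move=> s4; have [_ g01 _] := g_kernel.
pose X w := g (select_columns A (@nat_of_ord k) w) a.
have mX : measurable_fun setT X by exact: measurable_kernel_select.
have X01 w : 0 <= X w <= 1 by exact: g01.
have EX : (\int[P]_w (X w)%:E = p%:E)%E by exact: kernel_mean_select (@ord_inj k).
have /andP[p0 p1] := kernel_mean_bounded.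
(* The quadratic bound at [s * (X - p)] becomes affine in [X] through [X ^ 2 <= X]; the mean of
   [al + be * X] is [1 + 3 / 4 s ^ 2 p (1 - p)]. *)
pose al := 1 - s * p + 3 / 4 * s ^+ 2 * p ^+ 2.
pose be := s + 3 / 4 * s ^+ 2 * (1 - 2 * p).
apply: (@le_trans _ _ (\int[P]_w (al + be * X w)%:E)%E).
  apply: ge0_le_integral => //.
  - apply/measurable_EFinP; apply: measurableT_comp => //.
    apply: measurable_funM; first exact: measurable_cst.
    by apply: measurable_funB; [exact: mX|exact: measurable_cst].
  - apply/measurable_EFinP; apply: measurable_funD; first exact: measurable_cst.
    by apply: measurable_funM => //; exact: measurable_cst.
  - move=> w _; rewrite lee_fin -/(select_columns A (@nat_of_ord k) w) -/(X w).
    have /andP[X0 X1] := X01 w.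
    have sX4 : `|s * (X w - p)| <= 1 / 4.
      rewrite normrM -[leRHS]mulr1 ler_pM// ler_norml; apply/andP; split; lra.
    apply: le_trans (expR_le_quadratic sX4) _.
    have : 0 <= s ^+ 2 * (X w * (1 - X w)).
      by rewrite mulr_ge0 ?sqr_ge0// mulr_ge0// subr_ge0.
    rewrite /al /be; lra.
rewrite (integral_affine _ _ mX X01 EX) lee_fin.
apply: le_trans (expR_ge1Dx _).
by rewrite /al /be; lra.
Qed.

(** Jensen's inequality moves the exponential inside the average over permutations. For each
    permutation it is a product over [q] IID blocks, with integral [kernel_mgf (l / q) ^ q]. *)
Lemma ustat_mgf_le n q (l : R) : (0 < q)%N -> (k <= n)%N -> (q * k <= n)%N ->
  `|l / q%:R| <= 1 / 4 ->
  (\int[P]_w (expR (l * (U n w - p)))%:E <=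
    (expR (3 / 4 * l ^+ 2 / q%:R * (p * (1 - p))))%:E)%E.
Proof.
move=> q0 kn qkn lq4.
have n0 : 0 < n`!%:R :> R by rewrite ltr0n fact_gt0.
have qR : q%:R != 0 :> R by rewrite pnatr_eq0 -lt0n.
pose h (M : 'M[R]_(m, k)) := (expR (l / q%:R * (g M a - p)))%:E.
have h0 M : (0 <= h M)%E by rewrite lee_fin expR_ge0.
have mh : measurable_fun setT h.
  apply/measurable_EFinP; apply: measurableT_comp => //.
  apply: measurable_funM; first exact: measurable_cst.
  by apply: measurable_funB; [exact: measurable_kernel|exact: measurable_cst].
pose f (s : 'S_n) (b : 'I_q) (j : 'I_k) : nat := s (widen_ord qkn (block_index b j)).
have mH s b : measurable_fun setT (fun w => h (select_columns A (f s b) w)).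
  exact: (measurableT_comp mh (measurable_select_columns A (f s b))).
have Hprod s : (\int[P]_w \prod_(b < q) h (select_columns A (f s b) w) =
    kernel_mgf (l / q%:R) ^+ q)%E.
  have [F injF Fs] := perm_nat_ext s.
  rewrite -(integral_block_product A_iid q injF mh h0).
  apply: eq_integral => w _; apply: eq_bigr => b _; congr (h _).
  by apply/matrixP => i j; rewrite !mxE /f -(Fs (widen_ord qkn (block_index b j))).
apply: (@le_trans _ _ (\int[P]_w ((n`!%:R^-1)%:E *
    \sum_(s : 'S_n) \prod_(b < q) h (select_columns A (f s b) w)))%E).
  apply: ge0_le_integral => //.
  - apply/measurable_EFinP; apply: measurableT_comp => //.
    apply: measurable_funM; first exact: measurable_cst.
    by apply: measurable_funB; [exact: measurable_ustat|exact: measurable_cst].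
  - apply: emeasurable_funM; first exact: measurable_cst.
    by apply: emeasurable_sum => s; exact: emeasurable_prod.
  - move=> w _; under eq_bigr do rewrite prodEFin -expR_sum.
    rewrite sumEFin -EFinM lee_fin -card_Sn.
    apply: le_trans (expR_average _ _); last by rewrite card_Sn fact_gt0.
    rewrite ler_expR (ustat_select kn qkn)// card_Sn.
    rewrite le_eqVlt; apply/orP; left; apply/eqP.
    set S := \sum_(s : 'S_n) (_ * _).
    have -> : \sum_(s : 'S_n) \sum_(b < q)
        (l / q%:R * (g (select_columns A (f s b) w) a - p)) =
        \sum_(s : 'S_n) (l * (q%:R^-1 *
          \sum_(b < q) g (select_columns A (f s b) w) a) - l * p).
      apply: eq_bigr => s _; rewrite -mulr_sumr sumrB sumr_const card_ord.
      by rewrite -[p *+ q]mulr_natl; field.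
    rewrite sumrB -mulr_sumr -/S sumr_const card_Sn -[_ *+ _]mulr_natl.
    by field; rewrite gt_eqF.
rewrite ge0_integralZl//; last 2 first.
- by apply: emeasurable_sum => s; exact: emeasurable_prod.
- by move=> w _; apply: sume_ge0 => s _; exact: prode_ge0.
rewrite ge0_integral_sum//; last 2 first.
- by move=> s; exact: emeasurable_prod.
- by move=> s w _; exact: prode_ge0.
set B := expR (3 / 4 * (l / q%:R) ^+ 2 * (p * (1 - p))).
have mgf0 : (0 <= kernel_mgf (l / q%:R))%E by apply: integral_ge0.
have mgfB := kernel_mgf_le lq4.
have mgfE : kernel_mgf (l / q%:R) = (fine (kernel_mgf (l / q%:R)))%:E.
  by rewrite fineK// ge0_fin_numE// (le_lt_trans mgfB)// ltry.
apply: (@le_trans _ _ ((n`!%:R^-1)%:E * \sum_(s : 'S_n) (B ^+ q)%:E)%E).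
  rewrite lee_pmul2l ?lte_fin ?invr_gt0//; apply: lee_sum => s _.
  rewrite Hprod mgfE -EFin_expe lee_fin lerXn2r// ?nnegrE ?fine_ge0 ?expR_ge0//.
  by rewrite -lee_fin -mgfE.
rewrite sumEFin -EFinM lee_fin sumr_const card_Sn -[X in _ * X]mulr_natl.
rewrite mulKf ?gt_eqF// /B -expRM_natl ler_expR le_eqVlt; apply/orP; left.
by apply/eqP; field.
Qed.

(** Chernoff's bound, where the sign [e] selects the tail. The bound [t <= 3 / 8 v] is what gives
    [l / q = 2 t / (3 v) <= 1 / 4], the range of [ustat_mgf_le]. *)
Lemma ustat_one_sided n q (t e : R) : (0 < q)%N -> (k <= n)%N -> (q * k <= n)%N ->
  0 < p * (1 - p) -> 0 <= t <= 3 / 8 * (p * (1 - p)) -> `|e| = 1 ->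
  (P [set w | (t <= e * (U n w - p))%R] <=
    (expR (- (q%:R * t ^+ 2 / (3 * (p * (1 - p))))))%:E)%E.
Proof.
move=> q0 kn qkn; set v := p * (1 - p) => v0 /andP[t0 tv] e1.
have qR : 0 < q%:R :> R by rewrite ltr0n.
have mU := measurable_ustat kn.
(* [l] minimises the Chernoff exponent [- l t + 3 / 4 l ^ 2 v / q] *)
pose l := 2 * q%:R * t / (3 * v).
have l0 : 0 <= l.
  by rewrite divr_ge0 ?(mulr_ge0 _ (ltW v0))// mulr_ge0// mulr_ge0.
have eeE : e * e = 1 by rewrite -expr2 -(@real_normK _ e) ?num_real// e1 expr1n.
have mX : measurable_fun setT (fun w => e * (U n w - p)).
  by apply: measurable_funM => //; apply: measurable_funB.
have mE : measurable [set w | t <= e * (U n w - p)].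
  by rewrite -[X in measurable X]setTI; exact: measurable_fun_le.
have lq4 : `|e * l / q%:R| <= 1 / 4.
  rewrite -mulrA normrM e1 [leLHS]mul1r ger0_norm ?(divr_ge0 l0)//.
  have -> : l / q%:R = 2 * t / (3 * v) by rewrite /l; field; rewrite !gt_eqF.
  have v3 : 0 < 3 * v by rewrite pmulr_rgt0.
  rewrite ler_pdivrMr//. lra.
rewrite -(setIT [set w | _]) -integral_indic//.
(* The indicator of the event is at most [expR (l * (e * (U - p) - t))]. *)
apply: (@le_trans _ _ (\int[P]_w ((expR (- (l * t)))%:E *
    (expR (e * l * (U n w - p)))%:E))%E).
  apply: ge0_le_integral => //.
  - exact/measurable_EFinP/measurable_indic.
  - apply: emeasurable_funM; first exact: measurable_cst.
    apply/measurable_EFinP; apply: measurableT_comp => //.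
    by apply: measurable_funM => //; apply: measurable_funB.
  - move=> w _; rewrite -EFinM lee_fin -expRD indicE.
    case: (boolP (w \in _)) => [|_]; last by rewrite expR_ge0.
    rewrite inE /= => tU; apply: le_trans (expR_ge1Dx _); rewrite lerDl.
    have := ler_wpM2l l0 tU; rewrite -subr_ge0; lra.
rewrite ge0_integralZl//; last first.
- apply/measurable_EFinP; apply: measurableT_comp => //.
  by apply: measurable_funM => //; apply: measurable_funB.
apply: (le_trans (lee_wpmul2l _ (ustat_mgf_le q0 kn qkn lq4))).
  by rewrite lee_fin expR_ge0.
rewrite -EFinM lee_fin -expRD ler_expR -/v exprMn expr2 eeE mul1r.
rewrite le_eqVlt; apply/orP; left; apply/eqP.
by rewrite /l; field; rewrite !gt_eqF.
Qed.

Lemma measurable_deviation n (t : R) : (k <= n)%N ->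
  measurable [set w | t < `|U n w - p|].
Proof.
move=> kn; have mU := measurable_ustat kn.
have -> : [set w | t < `|U n w - p|] = ~` [set w | `|U n w - p| <= t].
  by apply/seteqP; split => w /=; rewrite ltNge => /negP.
apply: measurableC; rewrite -[X in measurable X]setTI.
apply: measurable_fun_le => //.
by apply: measurableT_comp => //; apply: measurable_funB.
Qed.

Lemma ustat_deviation n q (t : R) : (0 < q)%N -> (k <= n)%N -> (q * k <= n)%N ->
  0 < p * (1 - p) -> 0 <= t <= 3 / 8 * (p * (1 - p)) ->
  (P [set w | (t < `|U n w - p|)%R] <=
    (2 * expR (- (q%:R * t ^+ 2 / (3 * (p * (1 - p))))))%:E)%E.
Proof.
move=> q0 kn qkn v0 t0.
have mU := measurable_ustat kn.
have mE e : measurable [set w | t <= e * (U n w - p)].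
  rewrite -[X in measurable X]setTI; apply: measurable_fun_le => //.
  by apply: measurable_funM => //; apply: measurable_funB.
apply: (@le_trans _ _ (P ([set w | (t <= 1 * (U n w - p))%R] `|`
    [set w | (t <= -1 * (U n w - p))%R]))).
  apply: le_measure; rewrite ?inE//.
  - exact: measurable_deviation.
  - exact: measurableU.
  - move=> w /=; rewrite mul1r mulN1r lter_normr => /orP[/ltW|/ltW]; [by left|by right].
apply: (le_trans (measureU2 _ _ _)) => //.
rewrite mulr2n mulrDl mul1r EFinD leeD//; apply: ustat_one_sided => //.
  by rewrite normr1.
by rewrite normrN normr1.
Qed.

End ustat_moments.

(** * Almost sure bounds *)

(* Between [i ^ 2] and [(i + 1) ^ 2] the U-statistic moves by at most [2 k / i];
   [threshold] reserves that much below a lower bound for [epsilon k p n] valid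
   on the whole range. *)
Definition threshold_sq {R : realType} (k : nat) (v : R) (i : nat) : R :=
  2 * v * k%:R * ln (i%:R ^+ 2 / k%:R) / i.+1%:R ^+ 2.

Definition threshold {R : realType} (k : nat) (v : R) (i : nat) : R :=
  Num.sqrt (threshold_sq k v i) - 2 * k%:R / i%:R.

(** * Asymptotics of the thresholds along squares *)

Section thresholds.
Context {R : realType}.

Lemma near_ln_ge (c : R) : \forall i \near \oo, c <= ln (i%:R : R).
Proof.
have := nbhs_infty_ger (expR c); apply: filterS => i ci.
by rewrite -ler_expR lnK// posrE (lt_le_trans (expR_gt0 c)).
Qed.

(** On the range of [n], [ln (n / k) / n] is bounded below by its numerator at [i ^ 2] over its
    denominator at [(i + 1) ^ 2]. *)
Lemma sqrt_threshold_le_epsilon (k n i : nat) (p : R) : (0 < k)%N ->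
  (0 < i)%N -> 0 <= p * (1 - p) -> (k <= i ^ 2)%N -> (i ^ 2 <= n <= i.+1 ^ 2)%N ->
  Num.sqrt (threshold_sq k (p * (1 - p)) i) <= epsilon k p n.
Proof.
move=> k0 i0 v0 ki /andP[iLn nLi]; rewrite /epsilon ler_wsqrtr//.
have kR : 0 < k%:R :> R by rewrite ltr0n.
have iR : 0 < i%:R :> R by rewrite ltr0n.
have nR : 0 < n%:R :> R by rewrite ltr0n (leq_trans _ iLn)// expn_gt0 i0.
have iLnR : i%:R ^+ 2 <= n%:R :> R by rewrite -natrX ler_nat.
have nLiR : n%:R <= i.+1%:R ^+ 2 :> R by rewrite -natrX ler_nat.
have ln0 : 0 <= ln (i%:R ^+ 2 / k%:R) :> R.
  by rewrite ln_ge0// ler_pdivlMr// mul1r -natrX ler_nat.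
have lnn : ln (i%:R ^+ 2 / k%:R) <= ln (n%:R / k%:R) :> R.
  by rewrite ler_ln ?posrE ?divr_gt0 ?exprn_gt0// ler_pM2r ?invr_gt0.
rewrite /threshold_sq invf_div.
have -> : 2 * (p * (1 - p)) * k%:R * ln (i%:R ^+ 2 / k%:R) / i.+1%:R ^+ 2 =
    (2 * (p * (1 - p)) * k%:R) * (ln (i%:R ^+ 2 / k%:R) / i.+1%:R ^+ 2).
  by rewrite -!mulrA.
have -> : 2 * p * (1 - p) * (k%:R / n%:R) * ln (n%:R / k%:R) =
    (2 * (p * (1 - p)) * k%:R) * (ln (n%:R / k%:R) / n%:R).
  by field; rewrite gt_eqF.
apply: ler_wpM2l; first exact: mulr_ge0 (mulr_ge0 (ler0n R 2) v0) (ler0n R k).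
by apply: ler_pM => //; rewrite lef_pV2// posrE exprn_gt0// ltr0n.
Qed.

(** The exponent is asymptotic to [4 / 3 * ln i], and [7 / 6] lies between [4 / 3] and the critical
    value 1. Four losses of a factor [31 / 32] are allowed: two from [t ^ 2], one from rounding
    [i ^ 2 / k] and passing to [(i + 1) ^ 2], one from [ln k]. They suffice because
    [4 * (31 / 32) ^ 4 > 7 / 2]. *)
Lemma threshold_exponent (k : nat) (v : R) : (0 < k)%N -> 0 < v ->
  \forall i \near \oo, [/\ (k <= i ^ 2)%N,
    0 <= threshold k v i <= 3 / 8 * v &
    7 / 6 * ln i%:R <=
      (i ^ 2 %/ k)%:R * threshold k v i ^+ 2 / (3 * v)].
Proof.
move=> k0 v0.
have kR : 1 <= k%:R :> R by rewrite ler1n.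
near=> i.
have i1 : 128 + 32 * k%:R <= i%:R :> R by near: i; exact: nbhs_infty_ger.
have i2 : 30 * k%:R / v <= i%:R :> R by near: i; exact: nbhs_infty_ger.
have l1 : 16 * k%:R <= ln i%:R :> R by near: i; exact: near_ln_ge.
have l2 : 100 * (100 * k%:R) / v <= ln i%:R :> R by near: i; exact: near_ln_ge.
move: i1 i2 l1 l2; set x : R := i%:R; set l := ln x; set c : R := k%:R => x1 x2 l1 l2.
rewrite -/c in kR.
have x0 : 0 < x by lra.
have xx : 1 * x <= x * x by rewrite ler_pM2r//; lra.
have c0 : 0 < c by lra.
have lx : l <= x by apply/ltW/ln_sublinear.
have ki : (k <= i ^ 2)%N.
  by rewrite -(ler_nat R) natrX expr2 -/x -/c; lra.
have iS : i.+1%:R = x + 1 :> R by rewrite -natr1.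
have y0 : 0 < x + 1 by lra.
have lnE : ln (x ^+ 2 / c) = 2 * l - ln c.
  rewrite ln_div ?posrE ?exprn_gt0// lnXn//; congr (_ - _).
  by rewrite -/l mulr_natl.
have lnc0 : 0 <= ln c by exact: ln_ge0.
have lncc : ln c <= c by apply/ltW/ln_sublinear.
have C2 : 31 / 16 * l <= ln (x ^+ 2 / c) by rewrite lnE; lra.
have C2' : ln (x ^+ 2 / c) <= 2 * l by rewrite lnE; lra.
have vl : 100 * (100 * c) <= v * l by rewrite [leRHS]mulrC -ler_pdivrMr.
have vx : 30 * c <= v * x by rewrite [leRHS]mulrC -ler_pdivrMr.
set L := threshold_sq k v i.
have LE : L = 2 * v * c * ln (x ^+ 2 / c) / (x + 1) ^+ 2.
  by rewrite /L /threshold_sq iS.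
have l0 : 0 < l by lra.
set B := ln (x ^+ 2 / c) in C2 C2' LE.
have B0 : 0 <= B by lra.
have vc0 : 0 <= v * c by rewrite pmulr_rge0// ltW.
have xx0 : 0 < (x + 1) ^+ 2 by rewrite exprn_gt0.
have L0 : 0 <= L.
  rewrite LE; apply: divr_ge0; last exact: ltW.
  by apply: mulr_ge0 => //; rewrite -mulrA mulr_ge0.
have LU : L <= (3 / 8 * v) ^+ 2.
  rewrite LE ler_pdivrMr//.
  have h1 : v * c * B <= v * c * (2 * x) by apply: ler_wpM2l => //; lra.
  have vx0 : 0 < v * x by rewrite pmulr_rgt0.
  have h2 : v * x * (30 * c) <= v * x * (v * x) by rewrite ler_pM2l.
  have h3 : 0 < v * (v * x) by rewrite pmulr_rgt0.
  have h4 : 0 < v * v by rewrite pmulr_rgt0.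
  have h5 : 0 <= v * c * x by rewrite mulr_ge0 ?(ltW x0).
  rewrite !expr2; lra.
(* This makes the reserved drift [2 * c / x] at most [s / 32]. *)
have LL : (64 * c / x) ^+ 2 <= L.
  rewrite LE ler_pdivlMr// -exprMn.
  have cx0 : 0 <= c / x by rewrite divr_ge0// ltW.
  have cx : c / x <= c by rewrite ler_pdivrMr// ler_peMr//; lra.
  have E : 64 * c / x * (x + 1) = 64 * c + 64 * (c / x).
    by field; rewrite gt_eqF.
  apply: (@le_trans _ _ ((128 * c) ^+ 2)).
    by rewrite E lerXn2r// ?nnegrE; lra.
  have h1 : c * (100 * (100 * c)) <= c * (v * l) by rewrite ler_pM2l.
  have h2 : v * c * (31 / 16 * l) <= v * c * B by apply: ler_wpM2l.
  have h3 : 0 < c * c by rewrite pmulr_rgt0.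
  rewrite expr2; lra.
set s := Num.sqrt L.
have s2 : s ^+ 2 = L by rewrite sqr_sqrtr.
have s0 : 0 <= s by exact: sqrtr_ge0.
have sU : s <= 3 / 8 * v.
  by rewrite -(@ler_pXn2r _ 2) ?nnegrE ?s2// pmulr_rge0// ltW.
have sL : 64 * c / x <= s.
  by rewrite -(@ler_pXn2r _ 2) ?nnegrE ?s2// divr_ge0 ?pmulr_rge0// ltW.
rewrite /threshold -/L -/s -/c -/x.
set t := s - _.
have tL : 31 / 32 * s <= t by rewrite /t; lra.
have tU : t <= s by rewrite /t lerBlDr lerDl divr_ge0 ?pmulr_rge0// ltW.
split => //; first by apply/andP; split; lra.
have t2 : (31 / 32) ^+ 2 * L <= t ^+ 2.
  rewrite -s2 -exprMn ler_pXn2r ?nnegrE//; lra.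
have qE : x ^+ 2 - c <= (i ^ 2 %/ k)%:R * c.
  have := divn_eq (i ^ 2) k => /(congr1 (fun n => n%:R : R)).
  rewrite natrX natrD natrM -/x -/c => ->.
  rewrite -addrA gerDl subr_le0 ler_nat; exact/ltnW/ltn_pmod.
set q : R := (i ^ 2 %/ k)%:R in qE *.
have C1 : 31 / 32 * (x + 1) ^+ 2 <= q * c.
  apply: le_trans qE; rewrite !expr2.
  have : (128 + 32 * c) * x <= x * x by rewrite ler_pM2r.
  have : 1 * c <= x * c by rewrite ler_pM2r//; lra.
  lra.
have q0 : 0 <= q by exact: ler0n.
rewrite ler_pdivlMr ?pmulr_rgt0//.
apply: (@le_trans _ _ (q * ((31 / 32) ^+ 2 * L))); last by rewrite ler_wpM2l.
set r := q * c / (x + 1) ^+ 2.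
have -> : q * ((31 / 32) ^+ 2 * L) = (31 / 32) ^+ 2 * 2 * (v * r * B).
  by rewrite LE /r; field; rewrite gt_eqF.
have r1 : 31 / 32 <= r by rewrite ler_pdivlMr.
have h1 : v * (31 / 32) * (31 / 16 * l) <= v * r * B.
  apply: ler_pM => //.
  - by rewrite pmulr_rge0//; lra.
  - lra.
  - by rewrite ler_pM2l.
have vl0 : 0 < v * l by rewrite pmulr_rgt0.
rewrite expr2; lra.
Unshelve. all: by end_near.
Qed.

End thresholds.

(** The integral test for the exponent [7 / 6], with primitive [- 6 x ^ (- 1 / 6)], follows from
    [ln (i + 1) - ln i >= 1 / (i + 1)] and [expR z >= 1 + z]. *)
Lemma expR_ln_telescope {R : realType} (i : nat) : (0 < i)%N ->
  expR (- (7 / 6 * ln i.+1%:R)) <=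
  6 * (expR (- (1 / 6 * ln i%:R)) - expR (- (1 / 6 * ln i.+1%:R))) :> R.
Proof.
move=> i0; have iR : 0 < i%:R :> R by rewrite ltr0n.
have jR : 0 < i.+1%:R :> R by rewrite ltr0n.
set y := ln i.+1%:R; set x := ln i%:R.
have xy : (i.+1%:R : R)^-1 <= y - x.
  have -> : y - x = - ln (i%:R / i.+1%:R) by rewrite ln_div ?posrE// opprB.
  have -> : i%:R / i.+1%:R = 1 + - (i.+1%:R)^-1 :> R.
    by rewrite -natr1; field; rewrite natr1 gt_eqF.
  rewrite lerNr; apply: le_ln1Dx.
  by rewrite ltrN2 invf_lt1// ltr1n ltnS.
have yE : expR (- y) = (i.+1%:R : R)^-1 by rewrite expRN lnK.
have -> : - (1 / 6 * x) = - (1 / 6 * y) + 1 / 6 * (y - x) by ring.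
have -> : - (7 / 6 * y) = - (1 / 6 * y) + - y by field.
rewrite !expRD yE -[X in _ <= 6 * (_ - X)]mulr1 -mulrBr mulrCA ler_pM2l ?expR_gt0//.
have := expR_ge1Dx (1 / 6 * (y - x)).
by move: (expR _) (_^-1) xy => e z; lra.
Qed.

(** First Borel-Cantelli lemma: the partial sums of the probabilities are at most
    [c 0 - c n <= c 0], and the exceptional set is the limit superior of [F]. *)
Lemma borel_cantelli_telescope {d} {T : measurableType d} {R : realType}
    (P : probability T R) (F : nat -> set T) (c : nat -> R) :
  (forall i, measurable (F i)) -> (forall i, 0 <= c i) ->
  (forall i, P (F i) <= (c i - c i.+1)%:E)%E ->
  {ae P, forall x, \forall i \near \oo, ~ F i x}.
Proof.
move=> mF c0 PF.
have sumF : (\sum_(i <oo) P (F i) <= (c 0%N)%:E)%E.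
  apply: lime_le; first exact: is_cvg_nneseries.
  apply: nearW => n.
  apply: (@le_trans _ _ (\sum_(0 <= i < n) (c i - c i.+1)%:E)%E).
    by apply: lee_sum => i _.
  rewrite sumEFin lee_fin (@telescope_sumr_eq _ 0 n (fun i => - c i))// => [|i _].
    by rewrite opprK addrC gerDl oppr_le0.
  by rewrite opprK addrC.
exists (lim_sup_set F); split.
- by apply: bigcapT_measurable => n; apply: bigcup_measurable => j _.
- by apply: lim_sup_set_cvg0 => //; exact: le_lt_trans sumF (ltry _).
move=> x /= nF n _; apply: contra_notP nF => nFx.
exists n => // j /= nj Fj; apply: nFx.
by exists j.
Qed.

Lemma exists_sqr_between (n : nat) : exists i, (i ^ 2 <= n < i.+1 ^ 2)%N.
Proof.
elim: n => [|n [i /andP[iLn nLi]]]; first by exists 0%N.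
have [ni|ni] := ltnP n.+1 (i.+1 ^ 2).
  by exists i; rewrite ni (leq_trans iLn).
exists i.+1; rewrite ni /= (leq_ltn_trans nLi)// ltn_exp2r//.
Qed.

(** * From squares to all sample sizes *)

Section almost_sure.
Context {d} {T : measurableType d} {R : realType} {P : probability T R}.
Context {m k : nat}.
Variables (g : 'M[R]_(m, k) -> R -> R) (a : R) (A : nat -> {RV P >-> 'cV[R]_m}).
Hypothesis k0 : (0 < k)%N.
Hypothesis g_kernel : bounded_kernel g.
Hypothesis A_iid : iid A.
Let p := kernel_mean A g a.
Let U n w := ustat g a (random_matrix A n w).

Lemma ustat_drift n j w : (k <= n)%N ->
  `|U (n + j) w - U n w| <= j%:R * (k%:R / n%:R).
Proof.
move=> kn; have nR : 0 < n%:R :> R by rewrite ltr0n (leq_trans k0).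
elim: j => [|j IHj]; first by rewrite addn0 subrr normr0 mul0r.
have step : `|U (n + j).+1 w - U (n + j) w| <= k%:R / n%:R.
  have -> : U (n + j) w =
      ustat g a (colsub (lift ord_max) (random_matrix A (n + j).+1 w)).
    congr (ustat g a _); apply/matrixP => i l; rewrite !mxE.
    by congr (A _ w i 0); rewrite /= /bump leqNgt ltn_ord.
  apply: (le_trans (ustat_increment a g_kernel _ k0 _)).
    by rewrite (leq_trans kn)// leq_addr.
  apply: ler_wpM2l => //; rewrite lef_pV2 ?posrE ?ltr0Sn// ler_nat.
  by rewrite -addnS leq_addr.
rewrite addnS -natr1 mulrDl mul1r.
apply: le_trans (ler_distD (U (n + j) w) _ _) _.
by rewrite addrC lerD.
Qed.

Lemma ae_threshold : 0 < p * (1 - p) -> {ae P, forall w, \forall i \near \oo,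
  `|U (i ^ 2) w - p| <= threshold k (p * (1 - p)) i}.
Proof.
move=> v0; have [N _ HN] := threshold_exponent k0 v0.
set v := p * (1 - p) in v0 HN *.
(* The shift passes the rank [N] and makes [I j] the successor of the positive integer [(N + j).+1],
   as [expR_ln_telescope] demands. *)
pose I j := (N + j).+2.
pose F j := [set w | threshold k v (I j) < `|U (I j ^ 2) w - p|].
(* Here [12 = 2 * 6]: 2 from the two tails, 6 from the telescoping bound. *)
pose c j : R := 12 * expR (- (1 / 6 * ln (N + j).+1%:R)).
have HI j := HN (I j) (leq_trans (leq_addr j N) (leqW (leqnSn _))).
have : {ae P, forall w, \forall j \near \oo, ~ F j w}.
  apply: (@borel_cantelli_telescope _ _ _ _ _ c) => j.
  - have [kI _ _] := HI j; exact: measurable_deviation.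
  - by rewrite mulr_ge0// expR_ge0.
  have [kI t0 tI] := HI j.
  have q0 : (0 < I j ^ 2 %/ k)%N by rewrite divn_gt0.
  apply: (le_trans (ustat_deviation g_kernel A_iid q0 kI (leq_trunc_div _ _) v0 t0)).
  rewrite lee_fin -/v.
  have := @expR_ln_telescope R (N + j).+1 isT.
  have : expR (- ((I j ^ 2 %/ k)%:R * threshold k v (I j) ^+ 2 / (3 * v))) <=
      expR (- (7 / 6 * ln (I j)%:R)) by rewrite ler_expR lerN2.
  rewrite /c addnS -/(I j); lra.
apply: filterS => w [M _ HM].
exists (M + N).+2 => // i /= Mi.
have iE : i = I (i - N.+2)%N by rewrite /I -addnS -addnS; lia.
rewrite iE leNgt; apply/negP/HM => /=; lia.
Qed.

Lemma ae_ustat_epsilon : {ae P, forall w, \forall n \near \oo,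
  `|U n w - p| <= epsilon k p n}.
Proof.
have /andP[p0 p1] := kernel_mean_bounded a g_kernel A_iid.
have v0 : 0 <= p * (1 - p) by rewrite mulr_ge0// subr_ge0.
have [v00|vN0] := eqVneq (p * (1 - p)) 0.
  have : {ae P, forall w, forall n, (k <= n)%N -> U n w = p}.
    apply/ae_foralln => n; have [kn|nk] := leqP k n; last by apply: aeW.
    by have := degenerate_ustat g_kernel A_iid kn v00; apply: filterS.
  apply: filterS => w Up; exists k => // n /= kn.
  by rewrite Up// subrr normr0 sqrtr_ge0.
have v1 : 0 < p * (1 - p) by rewrite lt_neqAle eq_sym vN0.
have := ae_threshold v1; apply: filterS => w [M _ HM].
(* Beyond this rank the integer square root [i] of [n] satisfies both [M <= i] and [k <= i ^ 2]. *)
exists ((M + k.+1) ^ 2)%N => // n /= Mn.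
have [i /andP[iLn nLi]] := exists_sqr_between n.
have iM : (M + k.+1 <= i)%N by rewrite -ltnS -(@ltn_exp2r _ _ 2)// (leq_ltn_trans Mn).
have i0 : (0 < i)%N by lia.
have ki : (k <= i ^ 2)%N by rewrite (leq_trans _ (leq_pexp2l _ (isT : 0 < 2)%N))//; lia.
apply: le_trans (sqrt_threshold_le_epsilon k0 i0 v0 ki _); last first.
  by rewrite iLn ltnW.
have Ui : `|U (i ^ 2) w - p| <= threshold k (p * (1 - p)) i by apply: HM => /=; lia.
(* At most [2 * i] increments separate [i ^ 2] from [n], each at most [k / i ^ 2]; this is exactly
   the amount subtracted in [threshold]. *)
have Un : `|U n w - U (i ^ 2) w| <= 2 * k%:R / i%:R.
  rewrite -{1}(subnKC iLn); apply: (le_trans (ustat_drift _ _ ki)).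
  have -> : 2 * k%:R / i%:R = (2 * i)%:R * (k%:R / (i ^ 2)%:R) :> R.
    by rewrite natrX natrM; field; rewrite pnatr_eq0 -lt0n.
  apply: ler_wpM2r; first by rewrite divr_ge0.
  by rewrite ler_nat; nia.
apply: le_trans (ler_distD (U (i ^ 2) w) _ _) _.
rewrite -[leRHS](subrK (2 * k%:R / i%:R)) addrC.
exact: lerD.
Qed.

End almost_sure.

Theorem theorem1 (d : measure_display) (T : measurableType d) (R : realType)
    (P : probability T R) (m k : nat) (m_ge1 : (1 <= m)%N) (k_ge1 : (1 <= k)%N)
    (g : 'M[R]_(m, k) -> R -> R) (g_kernel : bounded_kernel g) (a : R)
    (A : nat -> {RV P >-> 'cV[R]_m}) (A_iid : iid A) :
  let p := kernel_mean A g a in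
  [/\ forall (n : nat) (S : {set 'I_n}), (k <= n)%N -> #|S| = k ->
        ('E_P[fun w => g (columns (random_matrix A n w) S) a] = p%:E)%E,
      forall n : nat, (k <= n)%N ->
        ('E_P[fun w => ustat g a (random_matrix A n w)] = p%:E)%E &
      {ae P, forall w, \forall n \near \oo,
        `|ustat g a (random_matrix A n w) - p| <= epsilon k p n}].
Proof.
move=> p; split.
- by move=> n S _ Sk; exact: kernel_mean_columns.
- by move=> n kn; rewrite unlock; exact: expectation_ustat.
- exact: ae_ustat_epsilon.
Qed.
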